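(* There are four subsets $F_1,F_2,F_3,F_4$ of $\mathbb{R}$, each having exactly two nonempty closed convex components, such that every pairwise intersection $F_i\cap F_j$ ($i\neq j$) has exactly two nonempty closed convex components, while $F_1\cap F_2\cap F_3\cap F_4=\emptyset$.
   Context: A subset $F\subseteq\mathbb{R}$ has ''exactly two nonempty closed convex components'' if it has exactly two connected components and both of them are nonempty closed convex sets. *)

(* Defs.v *)
From mathcomp Require Import all_boot all_order all_algebra.
From mathcomp Require Import all_classical all_reals all_analysis.

Set Implicit Arguments.
Unset Strict Implicit.
Unset Printing Implicit Defensive.

Import Order.TTheory GRing.Theory Num.Theory.
Import numFieldNormedType.Exports.

Local Open Scope classical_set_scope.

Definition components (T : topologicalType) (A : set T) : set (set T) :=
  [set connected_component A x | x in A].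

(* The scalar module of [R] that [convex_set] expects is the regular one, [R^o];
   it is convertible to [R]. *)
Definition closed_convex (R : realType) (C : set R) : Prop :=
  [/\ C !=set0, closed C & convex_set (C : set R^o)].

Definition two_closed_convex_components (R : realType) (A : set R) : Prop :=
  exists C D : set R,
    [/\ C <> D, components A = [set C; D], closed_convex C & closed_convex D].

(* Main.v *)
(** The four sets [{0} ∪ [1,3]], [{0} ∪ [2,4]], [[0,1] ∪ {4}] and
    [[1,2] ∪ [3,4]] work. The points 4, 1, 2, 0 are each missed by exactly one of
    them, respectively the first, second, third and fourth. Helly's theorem rules
    out the naive choice in which the left pieces meet pairwise; here a piece of
    one set may instead meet both pieces of another across its gap. *)
Require Import Defs.
From mathcomp Require Import all_boot all_order all_algebra.
From mathcomp Require Import all_classical all_reals all_analysis.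
From mathcomp Require Import lra.

Local Open Scope classical_set_scope.

Import Order.TTheory GRing.Theory Num.Theory.
Import numFieldNormedType.Exports.

(** A connected subset of a separated union lies in one of its two pieces. The component of [x]
    meets [A] at [x], so it cannot lie in [B]. *)
Lemma connected_component_setUl (T : topologicalType) (A B : set T) (x : T) :
  separated A B -> connected A -> A x -> connected_component (A `|` B) x = A.
Proof.
move=> sAB cA Ax; apply/seteqP; split; last first.
  exact: connected_component_max.
have xAB : connected_component (A `|` B) x x.
  by apply: connected_component_refl; left.
have [//|CB] := connected_subset sAB (@connected_component_sub _ _ x)
  (@component_connected _ _ x).
have : (A `&` B) x by split => //; exact: CB.
by rewrite separated_disjoint.
Qed.

Lemma components_setU (T : topologicalType) (A B : set T) :
    A !=set0 -> B !=set0 -> connected A -> connected B -> separated A B ->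
  components (A `|` B) = [set A; B].
Proof.
move=> [a Aa] [b Bb] cA cB sAB; have sBA := sAB; rewrite separatedC in sBA.
apply/seteqP; split => [_ [x [Ax|Bx] <-]|_ [->|->]] /=.
- by left; exact: connected_component_setUl.
- by right; rewrite setUC; exact: connected_component_setUl.
- by exists a; [left|exact: connected_component_setUl].
- by exists b; [right|rewrite setUC; exact: connected_component_setUl].
Qed.

Lemma closed_convex_segment (R : realType) (a b : R) :
  (a <= b)%R -> closed_convex `[a, b].
Proof.
move=> ab; split; first by exists a; rewrite /= in_itv /= lexx.
- exact: interval_closed.
- move=> x y t; rewrite !inE /= !in_itv /= => /andP[ax xb] /andP[ay yb].
  have t0 : (0 <= t%:num)%R by exact: ge0.
  have t1 : (t%:num <= 1)%R by exact: le1.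
  (* Scaling in the regular module is multiplication, so the abstract convex combination unfolds to
     this formula. *)
  change (a <= t%:num * x + (1 - t%:num) * y <= b)%R.
  by apply/andP; split; nra.
Qed.

(** Degenerate segments serve as isolated points, so one shape covers the four sets and all their
    pairwise intersections. *)
Definition segments (R : realType) (a b c d : R) : set R := `[a, b] `|` `[c, d].

Lemma two_closed_convex_components_segments (R : realType) (a b c d : R) :
    (a <= b)%R -> (b < c)%R -> (c <= d)%R ->
  two_closed_convex_components (segments R a b c d).
Proof.
move=> ab bc cd; have [[Aa clA cvA] [Bc clB cvB]] :=
  (closed_convex_segment R _ _ ab, closed_convex_segment R _ _ cd).
have disj : `[a, b] `&` `[c, d] = set0.
  by rewrite -subset0 => x /=; rewrite !in_itv /=; lra.
exists `[a, b], `[c, d]; split => //.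
- move=> E; have : (`[a, b] `&` `[c, d]) a.
    by split; rewrite -?E /= in_itv /= lexx.
  by rewrite disj.
- apply: components_setU => //; try exact: segment_connected.
  (* Each segment is its own closure, so disjointness gives separation. *)
  by split; rewrite -?(closure_id _).1.
Qed.


(** Turns membership into linear inequalities that [lra] can decide. *)
Lemma segmentsE (R : realType) (a b c d x : R) :
  segments R a b c d x = ((a <= x <= b) || (c <= x <= d))%R :> Prop.
Proof.
rewrite /segments /= !in_itv /=; apply/propext; split => [[->//|->]|/orP[]].
- by rewrite orbT.
- by left.
- by right.
Qed.

Local Open Scope ring_scope.

Definition four_sets (R : realType) (i : 'I_4) : set R :=
  nth set0 [:: segments R 0 0 1 3; segments R 0 0 2 4;
               segments R 0 1 4 4; segments R 1 2 3 4] i.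

Definition excluded_point (R : realType) (i : 'I_4) : R :=
  nth 0 [:: 4; 1; 2; 0] i.

Lemma four_sets_excluded_point (R : realType) (i j : 'I_4) :
  four_sets R j (excluded_point R i) <-> i != j.
Proof.
by case: i => [[|[|[|[|//]]]] ?]; case: j => [[|[|[|[|//]]]] ?];
  rewrite /four_sets /excluded_point -val_eqE /= segmentsE; split => //; lra.
Qed.

(** For [i != j], the point excluded from the set of index [i] belongs to the set of index [j],
    which tells the two apart. *)
Lemma four_sets_inj (R : realType) : injective (four_sets R).
Proof.
move=> i j Fij; apply/eqP/negP => /negP ij.
have /(_ ij) := (four_sets_excluded_point R i j).2.
by rewrite -Fij => /(four_sets_excluded_point R i i).1; rewrite eqxx.
Qed.

Lemma two_closed_convex_components_four_sets (R : realType) (i : 'I_4) :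
  two_closed_convex_components (four_sets R i).
Proof.
by case: i => [[|[|[|[|//]]]] ?]; rewrite /four_sets /=;
  apply: two_closed_convex_components_segments; lra.
Qed.

Lemma two_closed_convex_components_four_setsI (R : realType) (i j : 'I_4) :
  i != j -> two_closed_convex_components (four_sets R i `&` four_sets R j).
Proof.
wlog ltij : i j / (i < j)%N => [th ij|_].
  have [lt|lt|/val_inj eqij] := ltngtP i j; first exact: th.
    by rewrite setIC; apply: th => //; rewrite eq_sym.
  by rewrite eqij eqxx in ij.
suff [a [b [c [d [ab bc cd ->]]]]] : exists a b c d,
    [/\ a <= b, b < c, c <= d
      & four_sets R i `&` four_sets R j = segments R a b c d].
  exact: two_closed_convex_components_segments.
case: i j ltij => [[|[|[|[|//]]]] ?] [[|[|[|[|//]]]] ?] //= _;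
  rewrite /four_sets /=;
  (* Endpoints of the intersections for the index pairs 01, 02, 03, then 12, 13, 23. *)
  [exists 0, 0, 2, 3|exists 0, 0, 1, 1|exists 1, 2, 3, 3
  |exists 0, 0, 4, 4|exists 2, 2, 3, 4|exists 1, 1, 4, 4];
  (split; [lra|lra|lra|]); apply/seteqP; split => x /=; rewrite !segmentsE;
  by [case; lra|split; lra].
Qed.

Lemma bigcap_four_sets (R : realType) : \bigcap_i four_sets R i = set0.
Proof.
rewrite -subset0 => x Fx; have {}Fx i := Fx i I.
(* The first two sets meet in [{0} ∪ [2,3]] and the last two in [{1} ∪ {4}], which are disjoint. *)
have := (Fx (inord 0), Fx (inord 1), Fx (inord 2), Fx (inord 3)).
by rewrite /four_sets !inordK //= !segmentsE => -[[[]]]; lra.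
Qed.

Local Close Scope ring_scope.

Theorem proposition5p1 (R : realType) :
  exists F : 'I_4 -> set R,
    [/\ injective F,
        forall i, two_closed_convex_components (F i),
        forall i j, i != j -> two_closed_convex_components (F i `&` F j)
      & \bigcap_i F i = set0].
Proof.
exists (four_sets R); split.
- exact: four_sets_inj.
- exact: two_closed_convex_components_four_sets.
- exact: two_closed_convex_components_four_setsI.
- exact: bigcap_four_sets.
Qed.
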